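(* Let $\mathbb{C}$ be a regular unital category with binary coproducts, functorial (comonadic) projective covers $(P,\delta,\varepsilon)$ and a natural imaginary splitting $t$. Let $\mathcal{S}$ be the class of intrinsic Schreier split epimorphisms (intrinsic Schreier points) in $\mathbb{C}$ with respect to $t$. Then $\mathbb{C}$ is an $\mathcal{S}$-protomodular category.
   Context: A regular unital category here is a pointed (with zero object $0$), finitely complete, regular category with binary coproducts in which, for all $A,B$, the comparison morphism $r_{A,B}\colon A+B\to A\times B$ (with $r_{A,B}\iota_A=\langle 1_A,0\rangle$, $r_{A,B}\iota_B=\langle 0,1_B\rangle$) is a regular epimorphism. Functorial (comonadic) projective covers: a comonad $(P,\delta,\varepsilon)$ on $\mathbb{C}$ such that, for every object $X$, $P(X)$ is projective with respect to regular epimorphisms and $\varepsilon_X\colon P(X)\to X$ is a regular epimorphism. Write $P^2=PP$. A natural imaginary splitting is a natural transformation $t\colon P((\cdot)\times(\cdot))\Rightarrow(\cdot)+(\cdot)$ (in two variables), with components $t_{A,B}\colon P(A\times B)\to A+B$, such that $r_{A,B}t_{A,B}=\varepsilon_{A\times B}$. For $u\colon A\to C$, $v\colon B\to C$, $(u\mid v)\colon A+B\to C$ denotes the copairing; $\langle-,-\rangle$ denotes pairing. A point is a split epimorphism $f\colon X\to Y$ with a chosen section $s\colon Y\to X$, $fs=1_Y$; let $k\colon K\to X$ be the kernel of $f$. The point $(f,s)$ is an intrinsic Schreier split epimorphism (intrinsic Schreier point) with respect to $t$ if there is a morphism $q\colon P(X)\to K$ such that (iS1) $(kq\mid sf\varepsilon_X)\,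 t_{P(X),P(X)}\, P(\langle 1_{P(X)},1_{P(X)}\rangle)\,\delta_X=\varepsilon_X$; (iS2) $q\,P((k\mid s))\,P(t_{K,Y})\,\delta_{K\times Y}=\pi_K\,\varepsilon_{K\times Y}$. A point $(f,s)$ is strong if $(k,s)$ is jointly extremal-epimorphic (any monomorphism through which both $k$ and $s$ factor is an isomorphism). $\mathsf{Pt}(\mathbb{C})$ is the category of points in $\mathbb{C}$, whose morphisms from $(f\colon X\to Y,s)$ to $(f'\colon X'\to Y',s')$ are pairs $(g\colon X\to X',h\colon Y\to Y')$ with $f'g=hf$ and $gs=s'h$. For a class $\mathcal{S}$ of points that is stable under pullback along arbitrary morphisms (the pullback of $(f,s)$ along $g\colon Z\to Y$ being $(\pi_Z\colon Z\times_YX\to Z,\langle 1_Z,sg\rangle)$), regarded as a full subcategory $\mathcal{S}\text{-}\mathsf{Pt}(\mathbb{C})$ of $\mathsf{Pt}(\mathbb{C})$, a pointed finitely complete category $\mathbb{C}$ is called $\mathcal{S}$-protomodular when: (1) every point in $\mathcal{S}\text{-}\mathsf{Pt}(\mathbb{C})$ is a strong point; (2) $\mathcal{S}\text{-}\mathsf{Pt}(\mathbb{C})$ is closed under finite limits in $\mathsf{Pt}(\mathbb{C})$. Being $\mathcal{S}$-protomodular thus includes the pullback-stability of $\mathcal{S}$. *)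

(* Defs.v *)
From Stdlib Require Import List FinFun ProofIrrelevance.

Set Implicit Arguments.
Unset Strict Implicit.
Unset Printing Implicit Defensive.

Declare Scope cat_scope.
Open Scope cat_scope.

Record category := Category {
  ob :> Type;
  hom : ob -> ob -> Type;
  idm : forall a, hom a a;
  comp : forall a b c, hom b c -> hom a b -> hom a c;
  comp_idl : forall a b (f : hom a b), comp (idm b) f = f;
  comp_idr : forall a b (f : hom a b), comp f (idm a) = f;
  comp_assoc : forall a b c d (h : hom c d) (g : hom b c) (f : hom a b),
    comp h (comp g f) = comp (comp h g) f
}.

Arguments hom {C} a b : rename.
Arguments idm {C} a : rename.
Arguments comp {C a b c} g f : rename.

Notation "g ∘ f" := (comp g f) (at level 40, left associativity) : cat_scope.

Record functor (C D : category) := Functor {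
  fob :> C -> D;
  fmap : forall a b : C, hom a b -> hom (fob a) (fob b);
  fmap_id : forall a, fmap (idm a) = idm (fob a);
  fmap_comp : forall a b c (g : hom b c) (f : hom a b),
    fmap (g ∘ f) = fmap g ∘ fmap f
}.

Arguments fmap {C D} F {a b} f : rename.

Definition finite_category (J : category) : Prop :=
  Finite J /\ forall i j : J, Finite (hom i j).

Record cone (J C : category) (D : functor J C) (v : C) := Cone {
  leg :> forall j, hom v (D j);
  leg_nat : forall i j (u : hom i j), fmap D u ∘ leg i = leg j
}.

Definition is_limit (J C : category) (D : functor J C) (v : C) (l : cone D v)
  : Prop :=
  forall (w : C) (c : cone D w), exists! u : hom w v, forall j, l j ∘ u = c j.

Definition finitely_complete (C : category) : Prop :=
  forall J : category, finite_category J ->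
  forall D : functor J C, exists (v : C) (l : cone D v), is_limit l.

Section Morphisms.
Context (C : category).

Definition mono (a b : C) (m : hom a b) : Prop :=
  forall w (u v : hom w a), m ∘ u = m ∘ v -> u = v.

Definition iso (a b : C) (f : hom a b) : Prop :=
  exists g : hom b a, g ∘ f = idm a /\ f ∘ g = idm b.

Definition is_pullback (a b c p : C) (f : hom a c) (g : hom b c)
  (p1 : hom p a) (p2 : hom p b) : Prop :=
  f ∘ p1 = g ∘ p2 /\
  forall w (u : hom w a) (v : hom w b), f ∘ u = g ∘ v ->
    exists! h : hom w p, p1 ∘ h = u /\ p2 ∘ h = v.

Definition is_coequalizer (a b e : C) (u v : hom a b) (q : hom b e) : Prop :=
  q ∘ u = q ∘ v /\
  forall w (h : hom b w), h ∘ u = h ∘ v -> exists! h' : hom e w, h' ∘ q = h.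

Definition regular_epi (a b : C) (e : hom a b) : Prop :=
  exists (w : C) (u v : hom w a), is_coequalizer u v e.

Definition regular : Prop :=
  finitely_complete C /\
  (forall (a b p : C) (f : hom a b) (p1 p2 : hom p a),
     is_pullback f f p1 p2 ->
     exists (e : C) (q : hom a e), is_coequalizer p1 p2 q) /\
  (forall (a b c p : C) (f : hom a c) (g : hom b c)
     (p1 : hom p a) (p2 : hom p b),
     is_pullback f g p1 p2 -> regular_epi f -> regular_epi p2).

Definition regular_projective (p : C) : Prop :=
  forall (a b : C) (e : hom a b), regular_epi e ->
  forall h : hom p b, exists h' : hom p a, e ∘ h' = h.

Definition jointly_extremal_epi (a b c : C) (u : hom a c) (v : hom b c)
  : Prop :=
  forall (w : C) (m : hom w c), mono m ->
    (exists u' : hom a w, m ∘ u' = u) ->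
    (exists v' : hom b w, m ∘ v' = v) -> iso m.

End Morphisms.

(** Chosen structure, registered as classes so that it stays implicit below. *)

Class zero_object (C : category) := ZeroObject {
  zob : C;
  to_zob : forall a : C, hom a zob;
  from_zob : forall a : C, hom zob a;
  to_zob_uniq : forall (a : C) (u : hom a zob), u = to_zob a;
  from_zob_uniq : forall (a : C) (u : hom zob a), u = from_zob a
}.

Definition zero (C : category) (zC : zero_object C) (a b : C) : hom a b :=
  from_zob b ∘ to_zob a.
Arguments zero {C zC} a b.

Class binary_products (C : category) := BinaryProducts {
  prod_ob : C -> C -> C;
  pr1 : forall a b, hom (prod_ob a b) a;
  pr2 : forall a b, hom (prod_ob a b) b;
  pairing : forall w a b, hom w a -> hom w b -> hom w (prod_ob a b);
  pr1_pairing : forall w a b (u : hom w a) (v : hom w b),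
    pr1 a b ∘ pairing u v = u;
  pr2_pairing : forall w a b (u : hom w a) (v : hom w b),
    pr2 a b ∘ pairing u v = v;
  pairing_uniq : forall w a b (h : hom w (prod_ob a b)),
    h = pairing (pr1 a b ∘ h) (pr2 a b ∘ h)
}.
Arguments pr1 {C _} a b.
Arguments pr2 {C _} a b.
Arguments pairing {C _ w a b} u v.

Class binary_coproducts (C : category) := BinaryCoproducts {
  sum_ob : C -> C -> C;
  in1 : forall a b, hom a (sum_ob a b);
  in2 : forall a b, hom b (sum_ob a b);
  copairing : forall w a b, hom a w -> hom b w -> hom (sum_ob a b) w;
  copairing_in1 : forall w a b (u : hom a w) (v : hom b w),
    copairing u v ∘ in1 a b = u;
  copairing_in2 : forall w a b (u : hom a w) (v : hom b w),
    copairing u v ∘ in2 a b = v;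
  copairing_uniq : forall w a b (h : hom (sum_ob a b) w),
    h = copairing (h ∘ in1 a b) (h ∘ in2 a b)
}.
Arguments in1 {C _} a b.
Arguments in2 {C _} a b.
Arguments copairing {C _ w a b} u v.

Notation "a × b" := (prod_ob a b) (at level 40, left associativity)
  : cat_scope.
Notation "a ⊕ b" := (sum_ob a b) (at level 50, left associativity)
  : cat_scope.
Notation "⟨ u , v ⟩" := (pairing u v) (format "⟨ u ,  v ⟩") : cat_scope.
Notation "⦅ u | v ⦆" := (copairing u v) (format "⦅ u  |  v ⦆") : cat_scope.

Definition prod_map (C : category) (pC : binary_products C)
  (a a' b b' : C) (u : hom a a') (v : hom b b') : hom (a × b) (a' × b') :=
  ⟨ u ∘ pr1 a b, v ∘ pr2 a b ⟩.
Arguments prod_map {C pC a a' b b'} u v.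

Definition sum_map (C : category) (cC : binary_coproducts C)
  (a a' b b' : C) (u : hom a a') (v : hom b b') : hom (a ⊕ b) (a' ⊕ b') :=
  ⦅ in1 a' b' ∘ u | in2 a' b' ∘ v ⦆.
Arguments sum_map {C cC a a' b b'} u v.

Record comonad (C : category) := Comonad {
  cfun :> functor C C;
  counit : forall a : C, hom (cfun a) a;
  comult : forall a : C, hom (cfun a) (cfun (cfun a));
  counit_nat : forall (a b : C) (f : hom a b),
    counit b ∘ fmap cfun f = f ∘ counit a;
  comult_nat : forall (a b : C) (f : hom a b),
    comult b ∘ fmap cfun f = fmap cfun (fmap cfun f) ∘ comult a;
  counit_comult : forall a : C, counit (cfun a) ∘ comult a = idm (cfun a);
  fmap_counit_comult : forall a : C,
    fmap cfun (counit a) ∘ comult a = idm (cfun a);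
  comult_comult : forall a : C,
    comult (cfun a) ∘ comult a = fmap cfun (comult a) ∘ comult a
}.
Arguments counit {C} P a : rename.
Arguments comult {C} P a : rename.

Definition has_projective_covers (C : category) (P : comonad C) : Prop :=
  forall a : C, regular_projective (P a) /\ regular_epi (counit P a).

Record point (C : category) := Point {
  tot : C;
  base : C;
  pt_epi : hom tot base;
  pt_sec : hom base tot;
  pt_splits : pt_epi ∘ pt_sec = idm base
}.

Record pt_hom (C : category) (p p' : point C) := PtHom {
  tot_map : hom (tot p) (tot p');
  base_map : hom (base p) (base p');
  pt_hom_epi : pt_epi p' ∘ tot_map = base_map ∘ pt_epi p;
  pt_hom_sec : tot_map ∘ pt_sec p = pt_sec p' ∘ base_map
}.

Lemma pt_hom_eq (C : category) (p p' : point C) (m n : pt_hom p p') :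
  tot_map m = tot_map n -> base_map m = base_map n -> m = n.
Proof.
destruct m, n; simpl; intros; subst; f_equal; apply proof_irrelevance.
Qed.

Definition pt_id (C : category) (p : point C) : pt_hom p p.
Proof.
refine (@PtHom C p p (idm (tot p)) (idm (base p)) _ _);
  now rewrite comp_idl, comp_idr.
Defined.

Definition pt_comp (C : category) (p p' p'' : point C)
  (n : pt_hom p' p'') (m : pt_hom p p') : pt_hom p p''.
Proof.
refine (@PtHom C p p'' (tot_map n ∘ tot_map m) (base_map n ∘ base_map m) _ _).
- now rewrite comp_assoc, pt_hom_epi, <- !comp_assoc, pt_hom_epi.
- now rewrite <- comp_assoc, pt_hom_sec, !comp_assoc, pt_hom_sec.
Defined.

Definition Pt (C : category) : category.
Proof.
refine (@Category (point C) (@pt_hom C) (@pt_id C) (@pt_comp C) _ _ _);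
  intros; apply pt_hom_eq; simpl; auto using comp_idl, comp_idr, comp_assoc.
Defined.

(** The equations of the morphism [m] force the section of [p'] to be the
    comparison ⟨1, s g⟩ into the pullback. *)
Definition pullback_stable (C : category) (S : point C -> Prop) : Prop :=
  forall (p p' : point C) (m : pt_hom p' p),
    is_pullback (pt_epi p) (base_map m) (tot_map m) (pt_epi p') ->
    S p -> S p'.

Definition closed_under_finite_limits_in_Pt (C : category)
  (S : point C -> Prop) : Prop :=
  forall J : category, finite_category J ->
  forall (D : functor J (Pt C)) (p : Pt C) (l : cone D p),
    is_limit l -> (forall j, S (D j)) -> S p.

Section Pointed.
Context {C : category} {zC : zero_object C}.

(** Kernels are not chosen; they are unique up to isomorphism and always exist
    in a finitely complete category, so quantifying over all of them (strong
    points) or asking for one (Schreier points) amounts to the same thing. *)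
Definition is_kernel (a b k : C) (i : hom k a) (f : hom a b) : Prop :=
  f ∘ i = zero k b /\
  forall w (u : hom w a), f ∘ u = zero w b -> exists! v : hom w k, i ∘ v = u.

Definition strong_point (p : point C) : Prop :=
  forall (K : C) (k : hom K (tot p)), is_kernel k (pt_epi p) ->
    jointly_extremal_epi k (pt_sec p).

Definition protomodular_wrt (S : point C -> Prop) : Prop :=
  finitely_complete C /\
  pullback_stable S /\
  (forall p : point C, S p -> strong_point p) /\
  closed_under_finite_limits_in_Pt S.

Context {pC : binary_products C} {cC : binary_coproducts C}.

Definition sum_to_prod (a b : C) : hom (a ⊕ b) (a × b) :=
  ⦅ ⟨ idm a, zero a b ⟩ | ⟨ zero b a, idm b ⟩ ⦆.

Definition regular_unital : Prop :=
  regular C /\ forall a b : C, regular_epi (sum_to_prod a b).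

Record imaginary_splitting (P : comonad C) := ImaginarySplitting {
  isplit :> forall a b : C, hom (P (a × b)) (a ⊕ b);
  isplit_nat : forall (a a' b b' : C) (u : hom a a') (v : hom b b'),
    sum_map u v ∘ isplit a b = isplit a' b' ∘ fmap P (prod_map u v);
  isplit_counit : forall a b : C,
    sum_to_prod a b ∘ isplit a b = counit P (a × b)
}.

Context {P : comonad C} (t : imaginary_splitting P).

Definition schreier1 (p : point C) (K : C) (k : hom K (tot p))
  (q : hom (P (tot p)) K) : Prop :=
  let X := tot p in
  ⦅ k ∘ q | pt_sec p ∘ pt_epi p ∘ counit P X ⦆ ∘ t (P X) (P X)
    ∘ fmap P ⟨ idm (P X), idm (P X) ⟩ ∘ comult P X
  = counit P X.

Definition schreier2 (p : point C) (K : C) (k : hom K (tot p))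
  (q : hom (P (tot p)) K) : Prop :=
  let Y := base p in
  q ∘ fmap P ⦅ k | pt_sec p ⦆ ∘ fmap P (t K Y) ∘ comult P (K × Y)
  = pr1 K Y ∘ counit P (K × Y).

Definition intrinsic_schreier (p : point C) : Prop :=
  exists (K : C) (k : hom K (tot p)),
    is_kernel k (pt_epi p) /\
    exists q : hom (P (tot p)) K, schreier1 k q /\ schreier2 k q.

End Pointed.

Arguments regular_unital C {zC pC cC}.
Arguments imaginary_splitting {C zC pC cC} P.

(* Main.v *)
Require Import Defs.
From Stdlib Require Import IndefiniteDescription.

(** Read a morphism [x : P W -> X] as an element of [X] at stage [W].  These are
    the morphisms from [W] to [X] in the coKleisli category of [P], and the
    splitting [t] equips them with a sum [u ⊞ v].  The sum is preserved by
    morphisms of the category ([comp_oplus]) and by change of stage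
    ([act_oplus]), and has [0] as left unit ([oplus_zero_l]): the elements of an
    object behave like those of a pointed magma, without associativity.

    In this language the two Schreier axioms say what they say for monoids.  By
    the Yoneda argument it suffices to state them at the generic elements
    [counit P X] of [X] and [counit P (K × Y)] of [K × Y]: then (iS1) is
    [k q(x) ⊞ s f(x) = x], and (iS2) is [q (k c ⊞ s y) = c].  Together they mean
    that every element [x] of the point has exactly one decomposition
    [x = a ⊞ s f(x)] with [f(a) = 0] ([intrinsic_schreierP]).  This condition
    mentions neither [q] nor a chosen kernel.

    The theorem is now a computation with elements.  For pullbacks and limits,
    the decomposition is found in each component, and uniqueness makes the
    components compatible.  Here limits of points are computed on total objects,
    since the functor [tot] has a left adjoint, built from the coproducts
    ([pt_limit_tot]).  Schreier points are strong because the decomposition of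
    the generic element shows that the regular epimorphism [counit P X] factors
    through every subobject of [X] containing both the kernel and the section
    ([schreier_strong]). *)

Set Implicit Arguments.
Unset Strict Implicit.
Unset Printing Implicit Defensive.

(** * Categorical preliminaries *)

Section Preliminaries.
Context {C : category}.

Lemma comp_reassoc (a b c d : C) (g : hom b c) (f : hom a b) (e : hom a c)
  (h : hom d a) : g ∘ f = e -> g ∘ (f ∘ h) = e ∘ h.
Proof. intros <-; apply comp_assoc. Qed.

Lemma zero_comp {zC : zero_object C} (a b c : C) (u : hom a b) :
  zero b c ∘ u = zero a c.
Proof. unfold zero. now rewrite <- comp_assoc, (to_zob_uniq (_ ∘ u)). Qed.

Lemma comp_zero {zC : zero_object C} (a b c : C) (u : hom b c) :
  u ∘ zero a b = zero a c.
Proof. unfold zero. now rewrite comp_assoc, (from_zob_uniq (u ∘ _)). Qed.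

Lemma comp_pairing {pC : binary_products C} (w w' a b : C)
  (u : hom w a) (v : hom w b) (h : hom w' w) : ⟨u, v⟩ ∘ h = ⟨u ∘ h, v ∘ h⟩.
Proof.
rewrite (pairing_uniq (⟨u, v⟩ ∘ h)), !comp_assoc.
now rewrite pr1_pairing, pr2_pairing.
Qed.

Lemma pairing_pr {pC : binary_products C} (a b : C) :
  ⟨pr1 a b, pr2 a b⟩ = idm (a × b).
Proof. rewrite (pairing_uniq (idm _)). now rewrite !comp_idr. Qed.

Lemma prod_map_pairing {pC : binary_products C} (w a a' b b' : C)
  (u : hom a a') (v : hom b b') (x : hom w a) (y : hom w b) :
  prod_map u v ∘ ⟨x, y⟩ = ⟨u ∘ x, v ∘ y⟩.
Proof.
unfold prod_map. rewrite comp_pairing, <- !comp_assoc.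
now rewrite pr1_pairing, pr2_pairing.
Qed.

Lemma comp_copairing {cC : binary_coproducts C} (w w' a b : C)
  (u : hom a w) (v : hom b w) (h : hom w w') : h ∘ ⦅u | v⦆ = ⦅h ∘ u | h ∘ v⦆.
Proof.
rewrite (copairing_uniq (h ∘ ⦅u | v⦆)), <- !comp_assoc.
now rewrite copairing_in1, copairing_in2.
Qed.

Lemma copairing_sum_map {cC : binary_coproducts C} (w a a' b b' : C)
  (u : hom a a') (v : hom b b') (x : hom a' w) (y : hom b' w) :
  ⦅x | y⦆ ∘ sum_map u v = ⦅x ∘ u | y ∘ v⦆.
Proof.
unfold sum_map. rewrite comp_copairing, !comp_assoc.
now rewrite copairing_in1, copairing_in2.
Qed.

Lemma regular_epi_factor_iso (a b w : C) (e : hom a b) (e' : hom a w)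
  (m : hom w b) : regular_epi e -> mono m -> m ∘ e' = e -> iso m.
Proof.
intros (d & u & v & Huv & He) Hm He'.
assert (Heq : e' ∘ u = e' ∘ v).
{ apply Hm. now rewrite !comp_assoc, He'. }
destruct (He _ e' Heq) as (h & Hh & _).
destruct (He _ e Huv) as (i & _ & Hi).
assert (Hmh : m ∘ h = idm b).
{ transitivity i; [symmetry|]; apply Hi.
  - now rewrite <- comp_assoc, Hh.
  - apply comp_idl. }
exists h; split; [|exact Hmh].
apply Hm. now rewrite comp_assoc, Hmh, comp_idl, comp_idr.
Qed.

End Preliminaries.

(** The shape of an equalizer: two parallel arrows from [true] to [false]. *)
Definition parallel_pair : category.
Proof.
refine (@Category bool
  (fun a b => match a, b with
    | true, false => bool
    | false, true => Empty_set
    | _, _ => unit end)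
  (fun a => match a with true => tt | false => tt end)
  (fun a b c => match a, b, c with
    | true, true, true => fun _ _ => tt
    | true, true, false => fun g _ => g
    | true, false, true => fun _ _ => tt
    | true, false, false => fun _ f => f
    | false, true, true => fun _ f => f
    | false, true, false => fun _ _ => tt
    | false, false, true => fun g _ => g
    | false, false, false => fun _ _ => tt end) _ _ _).
- intros [] [] f; now destruct f.
- intros [] [] f; now destruct f.
- intros [] [] [] [] h g f; now destruct h, g, f.
Defined.

Lemma parallel_pair_finite : finite_category parallel_pair.
Proof.
split.
- exists (cons true (cons false nil)). intros []; simpl; auto.
- intros [] []; simpl.
  + exists (cons tt nil). intros []; simpl; auto.
  + exists (cons true (cons false nil)). intros []; simpl; auto.
  + exists nil. intros [].
  + exists (cons tt nil). intros []; simpl; auto.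
Qed.

Definition parallel_diagram (C : category) (a b : C) (f g : hom a b) :
  functor parallel_pair C.
Proof.
refine (@Functor parallel_pair C (fun i : bool => if i then a else b)
  (fun i j : bool => match i, j with
    | true, true => fun _ => idm a
    | true, false => fun u : bool => if u then f else g
    | false, true => fun u : Empty_set => match u with end
    | false, false => fun _ => idm b end) _ _).
- now intros [].
- intros [] [] [] v u; try destruct v; try destruct u; simpl;
    now rewrite ?comp_idl, ?comp_idr.
Defined.

Definition parallel_cone (C : category) (a b w : C) (f g : hom a b)
  (u : hom w a) (H : f ∘ u = g ∘ u) : cone (parallel_diagram f g) w.
Proof.
refine (@Cone _ _ (parallel_diagram f g) w
  (fun i : bool => match i with true => u | false => f ∘ u end) _).
intros [] [] v; destruct v; simpl; now rewrite ?comp_idl.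
Defined.

Lemma kernel_exists (C : category) (zC : zero_object C) (a b : C)
  (f : hom a b) : finitely_complete C ->
  exists (K : C) (k : hom K a), is_kernel k f.
Proof.
intros HC.
destruct (HC _ parallel_pair_finite (parallel_diagram f (zero a b)))
  as (K & l & Hl).
set (k := l true : hom K a).
assert (Hf : f ∘ k = l false)
  by exact (@leg_nat _ _ _ _ l true false true).
assert (H0 : zero a b ∘ k = l false)
  by exact (@leg_nat _ _ _ _ l true false false).
rewrite zero_comp in H0.
exists K, k; split; [congruence|].
intros w u Hu.
assert (Hu' : f ∘ u = zero a b ∘ u) by now rewrite zero_comp.
destruct (Hl w (parallel_cone Hu')) as (v & Hv & Huniq).
exists v; split; [exact (Hv true)|].
intros v' Hv'. apply Huniq. intros []; simpl; [exact Hv'|].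
now rewrite <- Hf, <- Hv', comp_assoc.
Qed.

(** * Limits of points *)

Section PointLimits.
Context {C : category} {cC : binary_coproducts C}.

(** The value at [W] of the left adjoint of [tot]: a morphism of points from it
    to [p] is the same as a morphism [x : W -> tot p], sent to [free_point_map x]
    and recovered by restriction along [in1]. *)
Definition free_point (W : C) : point C :=
  @Point C (W ⊕ W) W ⦅idm W | idm W⦆ (in2 W W) (copairing_in2 _ _).

Definition free_point_map (W : C) (p : point C) (x : hom W (tot p)) :
  pt_hom (free_point W) p.
Proof.
refine (@PtHom C (free_point W) p ⦅x | pt_sec p ∘ (pt_epi p ∘ x)⦆
  (pt_epi p ∘ x) _ _); simpl.
- rewrite !comp_copairing, comp_assoc, pt_splits, comp_idl.
  now rewrite comp_idr.
- apply copairing_in2.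
Defined.

Lemma free_point_map_comp (W : C) (p p' : point C) (m : pt_hom p p')
  (x : hom W (tot p)) :
  pt_comp m (free_point_map x) = free_point_map (tot_map m ∘ x).
Proof.
apply pt_hom_eq; simpl.
- rewrite comp_copairing; f_equal.
  rewrite comp_assoc, pt_hom_sec, <- comp_assoc; f_equal.
  now rewrite !comp_assoc, pt_hom_epi.
- now rewrite !comp_assoc, pt_hom_epi.
Qed.

Lemma free_point_map_in1 (W : C) (p : point C) (x : hom W (tot p)) :
  tot_map (free_point_map x) ∘ in1 W W = x.
Proof. apply copairing_in1. Qed.

(** The functor [tot] is a right adjoint, hence preserves limits. *)
Lemma pt_limit_tot (J : category) (D : functor J (Pt C)) (p : Pt C)
  (l : cone D p) (W : C) (x : forall j, hom W (tot (D j))) :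
  is_limit l ->
  (forall i j (u : hom i j), tot_map (fmap D u) ∘ x i = x j) ->
  exists! y : hom W (tot p), forall j, tot_map (l j) ∘ y = x j.
Proof.
intros Hl Hx.
assert (Hnat : forall i j (u : hom i j),
  fmap D u ∘ (free_point_map (x i) : hom (free_point W : Pt C) (D i))
  = free_point_map (x j)).
{ intros i j u. rewrite <- (Hx i j u).
  exact (free_point_map_comp (fmap D u) (x i)). }
destruct (Hl _ (Cone Hnat)) as (m & Hm & Huniq).
exists (tot_map m ∘ in1 W W); split.
- intros j. rewrite comp_assoc, <- (free_point_map_in1 (x j)).
  f_equal. exact (f_equal (@tot_map _ _ _) (Hm j)).
- intros y Hy. rewrite (Huniq (free_point_map y)).
  + apply free_point_map_in1.
  + intros j; simpl. rewrite <- (Hy j). exact (free_point_map_comp (l j) y).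
Qed.

Lemma pt_limit_tot_joint_mono (J : category) (D : functor J (Pt C)) (p : Pt C)
  (l : cone D p) (W : C) (y y' : hom W (tot p)) : is_limit l ->
  (forall j, tot_map (l j) ∘ y = tot_map (l j) ∘ y') -> y = y'.
Proof.
intros Hl Hy.
destruct (@pt_limit_tot J D p l W (fun j => tot_map (l j) ∘ y) Hl)
  as (z & _ & Hz).
- intros i j u. rewrite comp_assoc. f_equal.
  exact (f_equal (@tot_map _ _ _) (leg_nat l u)).
- transitivity z; [symmetry|]; apply Hz; auto.
Qed.

(** The section embeds the base naturally in the total object, so that joint
    monicity on total objects passes to bases. *)
Lemma pt_limit_base_joint_mono (J : category) (D : functor J (Pt C)) (p : Pt C)
  (l : cone D p) (W : C) (y y' : hom W (base p)) : is_limit l ->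
  (forall j, base_map (l j) ∘ y = base_map (l j) ∘ y') -> y = y'.
Proof.
intros Hl Hy.
rewrite <- (comp_idl y), <- (comp_idl y'), <- (pt_splits p), <- !comp_assoc.
f_equal. apply (pt_limit_tot_joint_mono Hl). intros j.
rewrite !comp_assoc, pt_hom_sec, <- !comp_assoc. now f_equal.
Qed.

End PointLimits.

(** * The sum of imaginary elements *)

Section Elements.
Context {C : category} {zC : zero_object C} {pC : binary_products C}
  {cC : binary_coproducts C} {P : comonad C} (t : imaginary_splitting P).

(** The coKleisli composite [u w]: the restriction of [u] along the change of
    stage [w]. *)
Definition act (V W X : C) (u : hom (P W) X) (w : hom (P V) W) : hom (P V) X :=
  u ∘ (fmap P w ∘ comult P V).

Definition oplus (W X : C) (u v : hom (P W) X) : hom (P W) X :=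
  ⦅u | v⦆ ∘ t (P W) (P W) ∘ fmap P ⟨idm (P W), idm (P W)⟩ ∘ comult P W.

Local Infix "⊞" := oplus (at level 50, left associativity).

Lemma comp_act (V W X Y : C) (h : hom X Y) (u : hom (P W) X)
  (w : hom (P V) W) : act (h ∘ u) w = h ∘ act u w.
Proof. symmetry. apply comp_assoc. Qed.

Lemma act_counit (V W X : C) (h : hom W X) (w : hom (P V) W) :
  act (h ∘ counit P W) w = h ∘ w.
Proof.
unfold act. rewrite <- comp_assoc. f_equal.
now rewrite comp_assoc, counit_nat, <- comp_assoc, counit_comult, comp_idr.
Qed.

(** The coKleisli extension of [w] is a morphism of cofree coalgebras. *)
Lemma comult_extension (V W : C) (w : hom (P V) W) :
  comult P W ∘ (fmap P w ∘ comult P V)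
  = fmap P (fmap P w ∘ comult P V) ∘ comult P V.
Proof.
rewrite comp_assoc, comult_nat, <- comp_assoc, comult_comult.
now rewrite fmap_comp, comp_assoc.
Qed.

Lemma act_act (V W X Y : C) (q : hom (P X) Y) (u : hom (P W) X)
  (w : hom (P V) W) : act q (act u w) = act (act q u) w.
Proof.
unfold act. rewrite fmap_comp, <- !comp_assoc. now rewrite comult_extension.
Qed.

Lemma comp_oplus (W X Y : C) (h : hom X Y) (u v : hom (P W) X) :
  h ∘ (u ⊞ v) = (h ∘ u) ⊞ (h ∘ v).
Proof. unfold oplus. now rewrite <- comp_copairing, !comp_assoc. Qed.

(** The copairing of [0] and [v] factors through the comparison from the
    coproduct to the product, which [t] splits up to the counit. *)
Lemma oplus_zero_l (W X : C) (v : hom (P W) X) : zero (P W) X ⊞ v = v.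
Proof.
unfold oplus.
assert (H : ⦅zero (P W) X | v⦆ = v ∘ pr2 (P W) (P W) ∘ sum_to_prod (P W) (P W)).
{ unfold sum_to_prod. rewrite comp_copairing, <- !comp_assoc.
  now rewrite !pr2_pairing, comp_zero, comp_idr. }
rewrite H, <- !comp_assoc, (comp_reassoc _ (isplit_counit _ _ _)).
rewrite (comp_reassoc _ (counit_nat _ _)), <- comp_assoc, counit_comult, comp_idr.
now rewrite pr2_pairing, comp_idr.
Qed.

(** This is naturality of [t], at the coKleisli extension of [w]. *)
Lemma act_oplus (V W X : C) (u v : hom (P W) X) (w : hom (P V) W) :
  act (u ⊞ v) w = act u w ⊞ act v w.
Proof.
unfold oplus, act. set (e := fmap P w ∘ comult P V).
rewrite <- copairing_sum_map, <- !comp_assoc.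
rewrite (comp_reassoc _ (isplit_nat _ _ _)), <- !comp_assoc.
subst e. rewrite comult_extension.
rewrite !(comp_assoc (fmap P _) (fmap P _) (comult P V)), <- !fmap_comp.
now rewrite comp_pairing, prod_map_pairing, comp_idl, !comp_idr.
Qed.

(** This computes the morphism occurring in (iS2): it is the sum [k c ⊞ s y] at
    the generic pair [(c, y)] of [K × Y]. *)
Lemma copairing_split_oplus (K Y X : C) (k : hom K X) (s : hom Y X) :
  ⦅k | s⦆ ∘ t K Y
  = (k ∘ (pr1 K Y ∘ counit P (K × Y))) ⊞ (s ∘ (pr2 K Y ∘ counit P (K × Y))).
Proof.
unfold oplus. rewrite <- copairing_sum_map, <- !comp_assoc.
rewrite (comp_reassoc _ (isplit_nat _ _ _)), <- !comp_assoc.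
rewrite (comp_assoc (fmap P _) (fmap P _)), <- fmap_comp.
rewrite prod_map_pairing, !comp_idr, <- comp_pairing, pairing_pr, comp_idl.
now rewrite fmap_counit_comult, comp_idr.
Qed.

Lemma copairing_split_act (V K Y X : C) (k : hom K X) (s : hom Y X)
  (c : hom (P V) K) (y : hom (P V) Y) :
  act (⦅k | s⦆ ∘ t K Y) ⟨c, y⟩ = (k ∘ c) ⊞ (s ∘ y).
Proof.
rewrite copairing_split_oplus, act_oplus, !(comp_act k), !(comp_act s).
now rewrite !act_counit, pr1_pairing, pr2_pairing.
Qed.

(** * Schreier points in terms of elements *)

Definition decomposition (p : point C) (W : C) (x a : hom (P W) (tot p)) :
  Prop :=
  pt_epi p ∘ a = zero (P W) (base p) /\ a ⊞ (pt_sec p ∘ (pt_epi p ∘ x)) = x.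

Definition uniquely_decomposable (p : point C) : Prop :=
  forall (W : C) (x : hom (P W) (tot p)), exists! a, decomposition x a.

Lemma decomposition_map (p p' : point C) (m : pt_hom p p') (W : C)
  (x a : hom (P W) (tot p)) :
  decomposition x a -> decomposition (tot_map m ∘ x) (tot_map m ∘ a).
Proof.
intros [Ha Hx]; split.
- now rewrite comp_assoc, pt_hom_epi, <- comp_assoc, Ha, comp_zero.
- rewrite (comp_reassoc _ (pt_hom_epi m)), <- (comp_assoc (base_map m)).
  rewrite (comp_assoc (pt_sec p')), <- pt_hom_sec, <- comp_assoc.
  now rewrite <- comp_oplus, Hx.
Qed.

Lemma schreier_decomposable (p : point C) :
  intrinsic_schreier t p -> uniquely_decomposable p.
Proof.
intros (K & k & (Hk0 & Hk) & q & H1 & H2) W x.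
exists (k ∘ act q x); split; [split|].
- now rewrite comp_assoc, Hk0, zero_comp.
- (* (iS1) is the identity at the generic element; restrict it along [x]. *)
  unfold schreier1 in H1; cbv zeta in H1.
  fold (oplus (k ∘ q) (pt_sec p ∘ pt_epi p ∘ counit P (tot p))) in H1.
  apply (f_equal (fun u => act u x)) in H1.
  rewrite act_oplus, comp_act, act_counit, <- comp_assoc in H1.
  rewrite H1, <- (comp_idl (counit P (tot p))), act_counit. apply comp_idl.
- intros b [Hb Hx].
  destruct (Hk _ b Hb) as (c & Hc & _). rewrite <- Hc in Hx |- *. f_equal.
  rewrite <- Hx at 1. rewrite <- copairing_split_act, act_act.
  (* (iS2) is the identity at the generic pair; restrict it along the pair of
     [c] and [f x]. *)
  assert (Hq : act q (⦅k | pt_sec p⦆ ∘ t K (base p))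
    = pr1 K (base p) ∘ counit P (K × base p)).
  { rewrite <- H2. unfold act. now rewrite fmap_comp, !comp_assoc. }
  now rewrite Hq, act_counit, pr1_pairing.
Qed.

(** Yoneda: [q] is read off from the decomposition of the generic element, which
    makes (iS1) its defining property; (iS2) then follows from uniqueness. *)
Lemma decomposable_schreier (p : point C) : finitely_complete C ->
  uniquely_decomposable p -> intrinsic_schreier t p.
Proof.
intros HC Hp.
destruct (kernel_exists zC (pt_epi p) HC) as (K & k & Hk0 & Hk).
exists K, k; split; [now split|].
destruct (Hp _ (counit P (tot p))) as (a & (Ha0 & Ha) & _).
destruct (Hk _ a Ha0) as (q & Hq & _). subst a.
exists q; split.
- red. cbv zeta. rewrite <- (comp_assoc (pt_sec p)). exact Ha.
- set (x := ⦅k | pt_sec p⦆ ∘ t K (base p)).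
  set (c := pr1 K (base p) ∘ counit P (K × base p)).
  assert (Hx : (k ∘ c) ⊞ (pt_sec p ∘ (pr2 K (base p) ∘ counit P (K × base p)))
    = x) by (symmetry; apply copairing_split_oplus).
  assert (Hfx : pt_epi p ∘ x = pr2 K (base p) ∘ counit P (K × base p)).
  { rewrite <- Hx, comp_oplus, (comp_reassoc _ Hk0), zero_comp, oplus_zero_l.
    now rewrite comp_assoc, pt_splits, comp_idl. }
  (* Composed with [k], both sides of (iS2) decompose [x]. *)
  assert (Hkc : k ∘ act q x = k ∘ c).
  { destruct (Hp _ x) as (b & _ & Hb).
    transitivity b; [symmetry|]; apply Hb; split.
    - now rewrite comp_assoc, Hk0, zero_comp.
    - apply (f_equal (fun u => act u x)) in Ha.
      rewrite act_oplus, comp_act, !(comp_act (pt_sec p)), act_counit in Ha.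
      rewrite Ha, <- (comp_idl (counit P (tot p))), act_counit. apply comp_idl.
    - now rewrite comp_assoc, Hk0, zero_comp.
    - now rewrite Hfx. }
  assert (Hqc : act q x = c).
  { destruct (Hk _ (k ∘ c)) as (v & _ & Hv).
    - now rewrite comp_assoc, Hk0, zero_comp.
    - transitivity v; [symmetry|]; now apply Hv. }
  red; cbv zeta. fold c. rewrite <- Hqc. unfold act, x.
  now rewrite fmap_comp, !comp_assoc.
Qed.

Lemma intrinsic_schreierP (p : point C) : finitely_complete C ->
  intrinsic_schreier t p <-> uniquely_decomposable p.
Proof.
split; [apply schreier_decomposable|now apply decomposable_schreier].
Qed.

(** * Protomodularity *)

(** If the subobject [m] contains the kernel and the section, it contains both
    summands of the generic element [counit P (tot p)], hence their sum; and a
    regular epimorphism factors through no proper subobject. *)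
Lemma schreier_strong (p : point C) : has_projective_covers P ->
  uniquely_decomposable p -> strong_point p.
Proof.
intros HP Hp K k [_ Hk] M m Hm (u & Hu) (v & Hv).
destruct (Hp _ (counit P (tot p))) as (a & (Ha0 & Ha) & _).
destruct (Hk _ a Ha0) as (q & Hq & _).
apply (@regular_epi_factor_iso _ _ _ _ (counit P (tot p))
  ((u ∘ q) ⊞ (v ∘ (pt_epi p ∘ counit P (tot p)))));
  [apply (HP (tot p))|exact Hm|].
now rewrite comp_oplus, !(comp_assoc m), Hu, Hv, Hq.
Qed.

(** An element of the pullback is a pair [(z, x)], whose decomposition is
    [(0, a)] when that of [x] is [a]. *)
Lemma decomposable_pullback_stable : pullback_stable uniquely_decomposable.
Proof.
intros p p' m [_ Hpb] Hp W x.
assert (Hext : forall b b' : hom (P W) (tot p'),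
  tot_map m ∘ b = tot_map m ∘ b' -> pt_epi p' ∘ b = pt_epi p' ∘ b' -> b = b').
{ intros b b' Ht He.
  destruct (Hpb _ (tot_map m ∘ b') (pt_epi p' ∘ b')) as (h & _ & Hh).
  - now rewrite !comp_assoc, pt_hom_epi.
  - transitivity h; [symmetry|]; now apply Hh. }
destruct (Hp _ (tot_map m ∘ x)) as (a & (Ha0 & Ha) & Huniq).
destruct (Hpb _ a (zero (P W) (base p'))) as (b & (Hmb & Hb0) & _).
{ now rewrite Ha0, comp_zero. }
exists b; split; [split|].
- exact Hb0.
- apply Hext; rewrite comp_oplus.
  + rewrite Hmb, (comp_assoc (tot_map m)), pt_hom_sec, <- comp_assoc.
    rewrite (comp_assoc (base_map m)), <- pt_hom_epi, <- (comp_assoc (pt_epi p)).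
    exact Ha.
  + now rewrite Hb0, oplus_zero_l, comp_assoc, pt_splits, comp_idl.
- intros b' Hb'. apply Hext.
  + rewrite Hmb. apply Huniq. now apply decomposition_map.
  + destruct Hb' as [Hb' _]. now rewrite Hb0, Hb'.
Qed.

Lemma decomposable_limit (J : category) (D : functor J (Pt C)) (p : Pt C)
  (l : cone D p) : is_limit l -> (forall j, uniquely_decomposable (D j)) ->
  uniquely_decomposable p.
Proof.
intros Hl HD W x.
assert (Hnat : forall i j (u : hom i j),
  tot_map (fmap D u) ∘ (tot_map (l i) ∘ x) = tot_map (l j) ∘ x).
{ intros i j u. rewrite comp_assoc. f_equal.
  exact (f_equal (@tot_map _ _ _) (leg_nat l u)). }
assert (Hdec : forall j, {a : hom (P W) (tot (D j)) |
  unique (decomposition (p := D j) (tot_map (l j) ∘ x)) a})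
  by (intros j; apply constructive_indefinite_description, HD).
(* Morphisms of points preserve decompositions, so by uniqueness those of the
   components of [x] form a cone. *)
destruct (@pt_limit_tot _ _ _ _ _ _ (P W) (fun j => proj1_sig (Hdec j)) Hl)
  as (a & Ha & _).
{ intros i j u. symmetry. apply (proj2_sig (Hdec j)). rewrite <- (Hnat i j u).
  apply decomposition_map, (proj2_sig (Hdec i)). }
exists a; split; [split|].
- apply (pt_limit_base_joint_mono Hl). intros j.
  rewrite comp_assoc, <- pt_hom_epi, <- comp_assoc, Ha, comp_zero.
  apply (proj2_sig (Hdec j)).
- apply (pt_limit_tot_joint_mono Hl). intros j.
  rewrite comp_oplus, Ha, (comp_assoc (tot_map _)), pt_hom_sec, <- comp_assoc.
  rewrite (comp_assoc (base_map _)), <- pt_hom_epi.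
  rewrite <- (comp_assoc (pt_epi (D j))).
  apply (proj2_sig (Hdec j)).
- intros b Hb. apply (pt_limit_tot_joint_mono Hl). intros j.
  rewrite Ha. apply (proj2_sig (Hdec j)). exact (decomposition_map (l j) Hb).
Qed.

End Elements.

Theorem corollary6p5 (C : category) (zC : zero_object C)
    (pC : binary_products C) (cC : binary_coproducts C)
    (HC : regular_unital C)
    (P : comonad C) (HP : has_projective_covers P)
    (t : imaginary_splitting P) :
  protomodular_wrt (intrinsic_schreier t).
Proof.
destruct HC as [[Hlim _] _].
split; [exact Hlim|split; [|split]].
- intros p p' m Hm Hp. apply intrinsic_schreierP; [exact Hlim|].
  apply (decomposable_pullback_stable Hm), schreier_decomposable, Hp.
- intros p Hp. apply (schreier_strong HP (schreier_decomposable Hp)).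
- intros J _ D p l Hl HD. apply intrinsic_schreierP; [exact Hlim|].
  apply (decomposable_limit Hl). intros j. apply schreier_decomposable, HD.
Qed.
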